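(* Let $T$ be a finite tree whose number of vertices is odd and which has at most two vertices of degree two. Then $T$ is edge-graceful; hence $T$ is also antimagic.
   Context: Graphs are finite and simple. A graph $G=(V,E)$ with $p=|V|$ vertices and $q=|E|$ edges is edge-graceful if there is a bijection $f:E\to\{1,2,\dots,q\}$ such that the induced map $f^+:V\to\mathbb Z/p\mathbb Z$, $f^+(v)=\sum_{e\ni v}f(e) \bmod p$ (sum over all edges $e$ incident with $v$), is a bijection from $V$ onto $\{0,1,\dots,p-1\}$ (equivalently, the vertex sums are pairwise distinct modulo $p$). A graph $G=(V,E)$ with $q$ edges is antimagic if there is a bijection $f:E\to\{1,2,\dots,q\}$ such that the integer vertex sums $\sum_{e\ni v}f(e)$, $v\in V$, are pairwise distinct. The order of a graph is its number of vertices. *)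

(* Defs.v *)
(* MathComp world. A graph on a finite vertex type V is given by its adjacency
   relation e : rel V, assumed symmetric and irreflexive where it is used. *)
From mathcomp Require Import all_boot.

Set Implicit Arguments.
Unset Strict Implicit.
Unset Printing Implicit Defensive.

Definition bij_onto (T : finType) (A : {set T}) (f : T -> nat)
    (B : pred nat) : Prop :=
  [/\ forall x, x \in A -> B (f x),
      {in A &, injective f}
    & forall k, B k -> exists2 x, x \in A & f x = k].

Definition edges (V : finType) (e : rel V) : {set {set V}} :=
  [set [set x; y] | x in [set: V], y in [set: V] & e x y].

Definition degree (V : finType) (e : rel V) (v : V) : nat :=
  #|[set w | e v w]|.

(* For symmetric e, an edge xy is itself a ucycle [:: x; y] of size 2, so
   graph cycles are exactly the ucycles of size at least 3. *)
Definition acyclic (V : finType) (e : rel V) : Prop :=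
  forall c : seq V, ucycle e c -> size c < 3.

Definition connected (V : finType) (e : rel V) : Prop :=
  0 < #|V| /\ forall x y : V, connect e x y.

Definition is_tree (V : finType) (e : rel V) : Prop :=
  connected e /\ acyclic e.

(* A labelling is a total function on {set V}; only its values on edges e
   matter. *)
Definition edge_labelling (V : finType) (e : rel V) (f : {set V} -> nat) : Prop :=
  bij_onto (edges e) f (fun k => 1 <= k <= #|edges e|).

Definition vertex_sum (V : finType) (e : rel V) (f : {set V} -> nat) (v : V) : nat :=
  \sum_(E in edges e | v \in E) f E.

(* Z/pZ is represented by the residues 0, ..., p - 1. *)
Definition edge_graceful (V : finType) (e : rel V) : Prop :=
  exists2 f : {set V} -> nat, edge_labelling e f &
    bij_onto [set: V] (fun v => vertex_sum e f v %% #|V|) (fun k => k < #|V|).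

Definition antimagic (V : finType) (e : rel V) : Prop :=
  exists2 f : {set V} -> nat, edge_labelling e f & injective (vertex_sum e f).

(* Main.v *)
Require Import Defs.
From mathcomp Require Import all_boot all_fingroup all_algebra zify.

Set Implicit Arguments.
Unset Strict Implicit.
Unset Printing Implicit Defensive.

Import GRing.Theory.

(* Root the tree at r and label the edge joining v to its parent by g v, where g
   is a bijection from the vertices to Z/pZ with g r = 0.  The sum at v is g v
   plus the labels of the children of v, so it suffices that every set of
   siblings has label sum 0.  Sets of siblings of even size are filled with pairs
   {x, -x}; those of odd size, an even number of them, also take one zero-sum
   triple each.  Disjoint triples come in pairs {x, y, -x-y}, {-x, -y, x+y} built
   from (hooked) Skolem sequences.  This fails only if some vertex has exactly
   one child, i.e. if r is a leaf or if some vertex other than r has degree two.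

   With two vertices u, w of degree two, a few labels are prescribed so that the
   sums of two vertices are exchanged while all other sums still equal the labels.
   Since p is odd, the number of vertices of even degree is odd, so some t other
   than u, w has even degree; it provides a set of siblings of suitable parity for
   the prescribed labels. *)

(** * Skolem sequences *)

(* The pairs {a d, a d + d} are disjoint and lie in {1, ..., 2n + 1}; 2n and
   2n + 1 do not both occur.  The triples (d, n + a d, n + a d + d) then remain
   disjoint up to sign even modulo 6n + 1, where 3n + 1 = - 3n. *)
Definition skolem_like (n : nat) (a : nat -> nat) :=
  forall d d', 0 < d <= n -> 0 < d' <= n ->
  [/\ 0 < a d, a d + d <= n.*2.+1, a d + a d' + d' <> (n.*2).*2.+1,
      a d + d + (a d' + d') <> (n.*2).*2.+1
    & d <> d' -> [/\ a d <> a d', a d + d <> a d' + d' & a d <> a d' + d']].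

(* skolem0 and skolem1 give Skolem sequences, skolem2 and skolem3 hooked Skolem
   sequences (position 2n is skipped). *)
Definition skolem0 s d :=
  if ~~ odd d then (12 * s - d)./2 else if d == 4 * s - 1 then 2 * s + 1
  else if 2 * s + 3 <= d then (4 * s - 1 - d)./2 else if d == 2 * s + 1 then s - 1
  else if d == 2 * s - 1 then 2 * s else if d == 1 then s else (4 * s + 1 - d)./2.

Lemma skolem0P s : 1 < s -> skolem_like (4 * s) (skolem0 s).
Proof.
move=> s1.
(* Writing the halves as linear equations in an auxiliary [e] leaves only linear arithmetic for each
   pair of cases. *)
have spec d : 0 < d <= 4 * s ->
    (exists e, d = 2 * e /\ skolem0 s d + e = 6 * s) \/
    (d = 4 * s - 1 /\ skolem0 s d = 2 * s + 1) \/
    (d = 2 * s + 1 /\ skolem0 s d = s - 1) \/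
    (d = 2 * s - 1 /\ skolem0 s d = 2 * s) \/
    (d = 1 /\ skolem0 s d = s) \/
    (exists e, d = 2 * e + 1 /\ s < e /\ e < 2 * s - 1 /\ skolem0 s d + e = 2 * s - 1) \/
    (exists e, d = 2 * e + 1 /\ 0 < e /\ e < s - 1 /\ skolem0 s d + e = 2 * s).
  move=> hd; rewrite /skolem0.
  have de := odd_double_half d.
  case: ifP => h1; first by left; exists d./2; lia.
  case: eqP => h2; first by right; left; lia.
  case: ifP => h3; first by do 5!right; left; exists d./2; lia.
  case: eqP => h4; first by do 2!right; left; lia.
  case: eqP => h5; first by do 3!right; left; lia.
  case: eqP => h6; first by do 4!right; left; lia.
  by do 6!right; exists d./2; lia.
move=> d d' hd hd'.
case: (spec d hd) => [[e ?]|[?|[?|[?|[?|[[e ?]|[e ?]]]]]]];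
case: (spec d' hd') => [[e' ?]|[?|[?|[?|[?|[[e' ?]|[e' ?]]]]]]]; (split; last (move=> ?; split)); lia.
Qed.
Definition skolem1 s d :=
  if ~~ odd d then 6 * s + 2 - d./2 else if d == 4 * s + 1 then 2 * s + 1
  else if d == 2 * s - 1 then 2 * s + 2 else if d == 1 then s + 1
  else if 2 * s + 1 <= d then 2 * s - d./2 else 2 * s + 1 - d./2.

Lemma skolem1P s : 1 < s -> skolem_like (4 * s + 1) (skolem1 s).
Proof.
move=> s1.
have spec d : 0 < d <= 4 * s + 1 ->
    (exists e, d = 2 * e /\ skolem1 s d + e = 6 * s + 2) \/
    (d = 4 * s + 1 /\ skolem1 s d = 2 * s + 1) \/
    (d = 2 * s - 1 /\ skolem1 s d = 2 * s + 2) \/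
    (d = 1 /\ skolem1 s d = s + 1) \/
    (exists e, d = 2 * e + 1 /\ s <= e /\ e < 2 * s /\ skolem1 s d + e = 2 * s) \/
    (exists e, d = 2 * e + 1 /\ 0 < e /\ e < s - 1 /\ skolem1 s d + e = 2 * s + 1).
  move=> hd; rewrite /skolem1; have de := odd_double_half d.
  case: ifP => h1; first by left; exists d./2; lia.
  case: eqP => h2; first by right; left; lia.
  case: eqP => h3; first by do 2!right; left; lia.
  case: eqP => h4; first by do 3!right; left; lia.
  case: ifP => h5; first by do 4!right; left; exists d./2; lia.
  by do 5!right; exists d./2; lia.
move=> d d' hd hd'.
case: (spec d hd) => [[e ?]|[?|[?|[?|[[e ?]|[e ?]]]]]];
case: (spec d' hd') => [[e' ?]|[?|[?|[?|[[e' ?]|[e' ?]]]]]]; (split; last (move=> ?; split)); lia.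
Qed.

Definition skolem2 s d :=
  if d == 4 * s + 2 then 4 * s + 3 else if ~~ odd d then 2 * s + 1 - d./2
  else if d == 4 * s + 1 then 2 * s + 1 else if d == 2 * s + 1 then 4 * s + 2
  else if d == 1 then 7 * s + 3 else if 2 * s + 1 <= d then 6 * s + 3 - d./2
  else 6 * s + 2 - d./2.

Lemma skolem2P s : 0 < s -> skolem_like (4 * s + 2) (skolem2 s).
Proof.
move=> s1.
have spec d : 0 < d <= 4 * s + 2 ->
    (d = 4 * s + 2 /\ skolem2 s d = 4 * s + 3) \/
    (exists e, d = 2 * e /\ e <= 2 * s /\ skolem2 s d + e = 2 * s + 1) \/
    (d = 4 * s + 1 /\ skolem2 s d = 2 * s + 1) \/
    (d = 2 * s + 1 /\ skolem2 s d = 4 * s + 2) \/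
    (d = 1 /\ skolem2 s d = 7 * s + 3) \/
    (exists e, d = 2 * e + 1 /\ s < e /\ e < 2 * s /\ skolem2 s d + e = 6 * s + 3) \/
    (exists e, d = 2 * e + 1 /\ 0 < e /\ e < s /\ skolem2 s d + e = 6 * s + 2).
  move=> hd; rewrite /skolem2; have de := odd_double_half d.
  case: eqP => h1; first by left; lia.
  case: ifP => h2; first by right; left; exists d./2; lia.
  case: eqP => h3; first by do 2!right; left; lia.
  case: eqP => h4; first by do 3!right; left; lia.
  case: eqP => h5; first by do 4!right; left; lia.
  case: ifP => h6; first by do 5!right; left; exists d./2; lia.
  by do 6!right; exists d./2; lia.
move=> d d' hd hd'.
case: (spec d hd) => [?|[[e ?]|[?|[?|[?|[[e ?]|[e ?]]]]]]];
case: (spec d' hd') => [?|[[e' ?]|[?|[?|[?|[[e' ?]|[e' ?]]]]]]]; (split; last (move=> ?; split)); lia.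
Qed.

Definition skolem3 s d :=
  if d == 4 * s - 2 then 2 * s + 1 else if ~~ odd d then 6 * s - 1 - d./2
  else if d == 4 * s - 1 then 4 * s else if d == 2 * s + 1 then s - 1
  else if d == 2 * s - 1 then 2 * s else if d == 1 then s
  else if 2 * s + 1 <= d then 2 * s - 1 - d./2 else 2 * s - d./2.

Lemma skolem3P s : 1 < s -> skolem_like (4 * s - 1) (skolem3 s).
Proof.
move=> s1.
have spec d : 0 < d <= 4 * s - 1 ->
    (d = 4 * s - 2 /\ skolem3 s d = 2 * s + 1) \/
    (exists e, d = 2 * e /\ e < 2 * s - 1 /\ skolem3 s d + e = 6 * s - 1) \/
    (d = 4 * s - 1 /\ skolem3 s d = 4 * s) \/
    (d = 2 * s + 1 /\ skolem3 s d = s - 1) \/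
    (d = 2 * s - 1 /\ skolem3 s d = 2 * s) \/
    (d = 1 /\ skolem3 s d = s) \/
    (exists e, d = 2 * e + 1 /\ s < e /\ e < 2 * s - 1 /\ skolem3 s d + e = 2 * s - 1) \/
    (exists e, d = 2 * e + 1 /\ 0 < e /\ e < s - 1 /\ skolem3 s d + e = 2 * s).
  move=> hd; rewrite /skolem3; have de := odd_double_half d.
  case: eqP => h1; first by left; lia.
  case: ifP => h2; first by right; left; exists d./2; lia.
  case: eqP => h3; first by do 2!right; left; lia.
  case: eqP => h4; first by do 3!right; left; lia.
  case: eqP => h5; first by do 4!right; left; lia.
  case: eqP => h6; first by do 5!right; left; lia.
  case: ifP => h7; first by do 6!right; left; exists d./2; lia.
  by do 7!right; exists d./2; lia.
move=> d d' hd hd'.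
case: (spec d hd) => [?|[[e ?]|[?|[?|[?|[?|[[e ?]|[e ?]]]]]]]];
case: (spec d' hd') => [?|[[e' ?]|[?|[?|[?|[?|[[e' ?]|[e' ?]]]]]]]]; (split; last (move=> ?; split)); lia.
Qed.

(** The general families start only at [n = 6]; shorter sequences, listed as [a 1, a 2, ...], are
    checked by computation. *)
Lemma skolem_like_small n s :
  let a d := nth 0 s d.-1 in
  all (fun d => all (fun d' => [&& 0 < a d, a d + d <= n.*2.+1,
      a d + a d' + d' != (n.*2).*2.+1, a d + d + (a d' + d') != (n.*2).*2.+1
    & (d != d') ==> [&& a d != a d', a d + d != a d' + d' & a d != a d' + d']])
    (iota 1 n)) (iota 1 n) ->
  skolem_like n a.
Proof.
move=> a /allP h d d' hd hd'.
have /h/allP/(_ d') : d \in iota 1 n by rewrite mem_iota; lia.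
rewrite mem_iota => /(_ _)/and5P[|? ? /eqP ? /eqP ? /implyP k]; first by lia.
by split=> // /eqP/k/and3P[/eqP ? /eqP ? /eqP ?].
Qed.

Lemma skolem_like_exists n : exists a, skolem_like n a.
Proof.
case: (ltnP n 8) => n8.
  case: n n8 => [|[|[|[|[|[|[|[|//]]]]]]]] _.
  - by eexists; apply: (@skolem_like_small _ [::]).
  - by eexists; apply: (@skolem_like_small _ [:: 1]).
  - by eexists; apply: (@skolem_like_small _ [:: 1; 3]).
  - by eexists; apply: (@skolem_like_small _ [:: 2; 5; 1]).
  - by eexists; apply: (@skolem_like_small _ [:: 1; 4; 5; 3]).
  - by eexists; apply: (@skolem_like_small _ [:: 8; 1; 4; 2; 5]).
  - by exists (skolem2 1); exact: (@skolem2P 1).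
  - by exists (skolem3 2); exact: (@skolem3P 2).
have := divn_eq n 4; have := ltn_pmod n (isT : 0 < 4).
set q := n %/ 4; case: (n %% 4) => [|[|[|[|//]]]] _ nE.
- by exists (skolem0 q); rewrite (_ : n = 4 * q); [apply: skolem0P|]; lia.
- by exists (skolem1 q); rewrite (_ : n = 4 * q + 1); [apply: skolem1P|]; lia.
- by exists (skolem2 q); rewrite (_ : n = 4 * q + 2); [apply: skolem2P|]; lia.
- by exists (skolem3 q.+1); rewrite (_ : n = 4 * q.+1 - 1); [apply: skolem3P|]; lia.
Qed.

(** * Zero-sum partitions *)

Lemma triple_count_odd (rs : seq nat) :
  all (fun k => k != 1) rs -> 3 * count odd rs <= sumn rs.
Proof. by elim: rs => [|k rs IH] //= /andP[k1 /IH]; case: (boolP (odd k)); lia. Qed.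

Lemma sumn_odd (rs : seq nat) : odd (sumn rs) = odd (count odd rs).
Proof. by elim: rs => [|k rs IH] //=; rewrite !oddD IH; case: (odd k). Qed.

Section Abelian.

Local Open Scope ring_scope.

Variable G : finZmodType.
Implicit Types (x y : G) (S : seq G) (T : seq (G * G)).

Definition block_sums_zero (B : seq (seq G)) := all (fun b => \sum_(x <- b) x == 0) B.

Lemma big_flatten_zero (B : seq (seq G)) :
  block_sums_zero B -> \sum_(x <- flatten B) x = 0.
Proof.
elim: B => [|b B IH] /=; first by rewrite big_nil.
by move=> /andP[/eqP b0 /IH B0]; rewrite big_cat /= b0 B0 addr0.
Qed.

(** Greedy: an odd block takes one triple of [TT], and pairs of [PP] fill the rest. The pairs cannot
    run out, since the total sizes agree and each later odd block has room for its own triple. *)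
Lemma zero_sum_partition (rs : seq nat) (TT PP : seq (seq G)) :
  all (fun k => k != 1)%N rs -> count odd rs = size TT ->
  all (fun b => size b == 3) TT -> all (fun b => size b == 2) PP ->
  block_sums_zero TT -> block_sums_zero PP ->
  (sumn rs = 3 * size TT + 2 * size PP)%N ->
  exists B, [/\ shape B = rs, block_sums_zero B
              & perm_eq (flatten B) (flatten TT ++ flatten PP)].
Proof.
elim: rs TT PP => [|k rs IH] TT PP /=.
  by case: TT PP => [|//] [|//] *; exists [::].
move=> /andP[k1 rs1] cTT TT3 PP2 TT0 PP0 sE.
have le3 := triple_count_odd rs1.
pose i := (k - 3 * odd k)./2.
have [t [TT' [tE t0 TTE cTT' TT'P]]] : exists t TT',
    [/\ size t = (3 * odd k)%N, \sum_(x <- t) x = 0, flatten TT = t ++ flatten TT',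
        size TT = (odd k + size TT')%N
      & all (fun b => size b == 3) TT' && block_sums_zero TT'].
  case: (odd k) cTT TT3 TT0 => /=.
    case: TT {sE} => //= t TT' _ /andP[/eqP t3 TT3] /andP[/eqP t0 TT0].
    by exists t, TT'; rewrite TT3.
  by move=> _ TT3 TT0; exists [::], TT; rewrite big_nil TT3.
have [kE iPP cE sE'] : [/\ k = 3 * odd k + 2 * i, i <= size PP,
    count odd rs = size TT' & sumn rs = 3 * size TT' + 2 * (size PP - i)]%N.
  move: cTT cTT' le3 k1 sE (odd_double_half k); rewrite /i.
  clear; case: (odd k) => /=; split; lia.
have size2 (B : seq (seq G)) :
    all (fun b => size b == 2) B -> size (flatten B) = (2 * size B)%N.
  by elim: B => //= b B IHB /andP[/eqP b2 /IHB]; rewrite size_cat; lia.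
move: PP2 PP0; rewrite -{1 2}(cat_take_drop i PP) all_cat /block_sums_zero all_cat.
move=> /andP[PPa PPb] /andP[PP0a PP0b]; case/andP: TT'P => TT'3 TT'0.
have [||B [BE B0 BP]] := IH TT' (drop i PP) rs1 _ TT'3 PPb TT'0 PP0b.
- exact: cE.
- by rewrite size_drop.
exists ((t ++ flatten (take i PP)) :: B); split=> /=.
- by rewrite BE size_cat size2 // size_takel // tE -kE.
- by rewrite -/(block_sums_zero B) B0 andbT big_cat /= t0 big_flatten_zero // addr0.
- rewrite -[in X in perm_eq _ X](cat_take_drop i PP) flatten_cat TTE -!catA perm_cat2l.
  by rewrite perm_sym perm_catCA perm_cat2l perm_sym.
Qed.

(** Vertices are listed as [r], [pre] and the classes [R v], group elements as 0, [lab] and zero-sum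
    blocks of the same sizes; [g] matches the two lists entry by entry. *)
Lemma labelling_of_blocks (V : finType) (r : V) (pre : seq V) (R : V -> {set V})
    (lab : seq G) (TT PP : seq (seq G)) :
  perm_eq (r :: pre ++ flatten [seq enum (R v) | v <- enum V]) (enum V) ->
  perm_eq (0 :: lab ++ flatten TT ++ flatten PP) (enum G) -> #|V| = #|G| ->
  size pre = size lab ->
  (forall v, #|R v| != 1)%N -> count (fun v => odd #|R v|) (enum V) = size TT ->
  all (fun b => size b == 3) TT -> all (fun b => size b == 2) PP ->
  block_sums_zero TT -> block_sums_zero PP ->
  exists g : V -> G, [/\ injective g, g r = 0, map g pre = lab
    & forall v, \sum_(w in R v) g w = 0].
Proof.
move=> vP lP VG sizeE R1 cR TT3 PP2 TT0 PP0.
pose cs := [seq enum (R v) | v <- enum V].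
have sizeF k (B : seq (seq G)) :
    all (fun b => size b == k) B -> size (flatten B) = (k * size B)%N.
  by elim: B => //= [|b B IHB /andP[/eqP b2 /IHB]]; rewrite ?size_cat; lia.
have shE : shape cs = [seq #|R v| | v <- enum V].
  by rewrite /shape -map_comp; apply: eq_map => v /=; rewrite -cardE.
have [|||B [BE B0 BP]] := @zero_sum_partition (shape cs) TT PP _ _ TT3 PP2 TT0 PP0 _.
- by rewrite shE all_map; apply/allP => v _; apply: R1.
- by rewrite shE count_map -cR.
- rewrite -size_flatten; move: (perm_size vP) (perm_size lP).
  rewrite /= !size_cat (sizeF 3%N TT) // (sizeF 2%N PP) // -!cardE VG sizeE -/cs.
  by move=> <- [/addnI].
pose vs := r :: pre ++ flatten cs; pose ls := 0 :: lab ++ flatten B.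
have lsP : perm_eq ls (enum G).
  by apply: perm_trans lP; rewrite perm_cons perm_cat2l.
have sE : size vs = size ls by rewrite (perm_size vP) (perm_size lsP) -!cardE.
have vsU : uniq vs by rewrite (perm_uniq vP) enum_uniq.
have lsU : uniq ls by rewrite (perm_uniq lsP) enum_uniq.
have vsin v : v \in vs by rewrite (perm_mem vP) mem_enum.
pose g v := nth 0 ls (index v vs).
have gE : map g vs = ls.
  apply: (@eq_from_nth _ 0) => [|i]; rewrite size_map // => isz.
  by rewrite (nth_map r) // /g index_uniq.
exists g; move: gE; rewrite /vs /ls /= map_cat => -[gr].
move=> /eqP; rewrite eqseq_cat ?size_map // => /andP[/eqP gpre /eqP gfl].
split=> //.
- move=> v w /eqP; rewrite /g nth_uniq -?sE ?index_mem //.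
  by move=> /eqP iE; rewrite -(nth_index r (vsin v)) iE nth_index.
(* Blocks and classes have the same shape, so equality of the flattened lists gives equality class
   by class. *)
- move=> v; have : [seq map g c | c <- cs] = B.
    by apply: eq_from_flatten_shape; rewrite -?map_flatten // BE /shape -map_comp;
       apply: eq_map => c /=; rewrite size_map.
  move=> csE; move: B0; rewrite -csE /cs /block_sums_zero all_map all_map => /allP/(_ v).
  rewrite mem_enum => /(_ isT) /= /eqP.
  by rewrite big_map big_enum.
Qed.

(** A partial choice of one element from each pair {x, -x} of nonzero elements; absence of
    repetitions also rules out x = -x. *)
Definition half_system S := uniq (0 :: S ++ map -%R S).

Lemma opp_mem S x : (x \in map -%R S) = (- x \in S).
Proof. by rewrite -{1}[x]opprK mem_map //; apply: oppr_inj. Qed.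

Lemma perm_opp_pairs S :
  perm_eq (flatten [seq [:: x; - x] | x <- S]) (S ++ map -%R S).
Proof.
elim: S => //= x S IH.
by rewrite perm_cons perm_sym -cat1s perm_catCA perm_cons perm_sym.
Qed.

Lemma half_systemP S :
  reflect [/\ 0 \notin S, uniq S & {in S, forall x, - x \notin S}] (half_system S).
Proof.
rewrite /half_system /= mem_cat opp_mem oppr0 orbb cat_uniq (map_inj_uniq oppr_inj).
apply: (iffP and4P) => [[S0 uS /hasPn hn _]|[S0 uS hn]]; split=> //.
  by move=> x xS; rewrite -opp_mem; apply/negP => /hn/negP.
apply/hasPn => x; rewrite opp_mem => /hn; rewrite opprK => xS; exact: xS.
Qed.

(* A pair (x, y) encodes the two zero-sum triples x, y, - (x + y) and
   - x, - y, x + y. *)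
Definition triple_support T := flatten [seq [:: t.1; t.2; t.1 + t.2] | t <- T].

Hypothesis no_2torsion : forall x, x + x = 0 -> x = 0.

(** Without 2-torsion a missing [x] differs from [- x], so it can join [S]; this is repeated until
    0, [S] and its negatives exhaust the group. *)
Lemma half_system_extend S : half_system S ->
  exists M, perm_eq (0 :: (S ++ M) ++ map -%R (S ++ M)) (enum G).
Proof.
have [k] := ubnP (#|G| - size S)%N; elim: k S => // k IH S kS hS.
case: (boolP (all (mem (0 :: S ++ map -%R S)) (enum G))) => [/allP all_in|].
  exists [::]; rewrite cats0 uniq_perm ?enum_uniq // => x.
  by rewrite mem_enum [RHS]inE; apply: all_in; rewrite mem_enum.
move=> /allPn[x _]; rewrite /= inE mem_cat opp_mem !negb_or => /and3P[x0 xS xNS].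
have hS' : half_system (x :: S).
  have [S0 uS hn] := half_systemP _ hS; apply/half_systemP; split.
  - by rewrite inE negb_or eq_sym x0.
  - by rewrite /= xS.
  move=> y; rewrite !inE negb_or => /orP[/eqP->|yS].
    rewrite xNS andbT; apply: contra x0 => /eqP xE.
    by apply/eqP/no_2torsion; rewrite -{1}xE addNr.
  by rewrite hn // andbT; apply: contra xNS => /eqP <-; rewrite opprK.
(* The enlarged [S] still fits into the group, so the truncated difference [#|G| - size S] really
   drops. *)
have := max_card (mem (0 :: (x :: S) ++ map -%R (x :: S))).
rewrite (card_uniqP hS') /= size_cat /= size_map => szle.
have [|M MP] := IH _ _ hS'; first by
  rewrite -ltnS (leq_trans _ kS) // ltnS ltn_sub2l // (leq_trans _ szle) //; lia.
exists (x :: M); apply: perm_trans MP.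
rewrite perm_cons; apply/seq.permP => a; rewrite !map_cat /= !count_cat /= !count_cat /=.
by lia.
Qed.

(** [S] and its negatives go to [pre], each entry of [T] yields two opposite triples, and the
    elements that complete the half system yield the pairs {x, -x}. *)
Lemma labelling_of_triples (V : finType) (r : V) (pre : seq V) (R : V -> {set V})
    S (lab : seq G) T :
  perm_eq (r :: pre ++ flatten [seq enum (R v) | v <- enum V]) (enum V) ->
  #|V| = #|G| -> size pre = size lab -> perm_eq lab (S ++ map -%R S) ->
  half_system (S ++ triple_support T) ->
  (forall v, #|R v| != 1)%N -> count (fun v => odd #|R v|) (enum V) = (size T).*2 ->
  exists g : V -> G, [/\ injective g, g r = 0, map g pre = lab
    & forall v, \sum_(w in R v) g w = 0].
Proof.
move=> vP VG sizeE labP hS R1 cR; have [M MP] := half_system_extend hS.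
pose P := [seq [:: t.1; t.2; - (t.1 + t.2)] | t <- T].
pose N := [seq [:: - t.1; - t.2; t.1 + t.2] | t <- T].
pose TT := P ++ N.
pose PP := [seq [:: x; - x] | x <- M].
apply: (@labelling_of_blocks V r pre R lab TT PP) => //.
- apply: perm_trans MP; rewrite perm_cons.
  apply/seq.permP => a; rewrite !map_cat !count_cat (seq.permP labP) count_cat.
  rewrite /TT flatten_cat count_cat.
  rewrite (seq.permP (perm_opp_pairs M)) count_cat.
  suff : (count a (flatten P) + count a (flatten N) =
       count a (triple_support T) + count a (map -%R (triple_support T)))%N.
    by move=> ->; rewrite (addnACA (count a (triple_support T))) addnACA !addnA.
  rewrite /P /N /triple_support; elim: T {hS cR P N TT} => //= t T.
  have regroup (i j k i' j' k' p n s s' : nat) : (p + n = s + s' ->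
      i + (j + (k' + p)) + (i' + (j' + (k + n))) =
      i + (j + (k + s)) + (i' + (j' + (k' + s'))))%N by lia.
  exact: regroup.
- by rewrite cR /TT size_cat !size_map addnn.
- by rewrite /TT all_cat !all_map; apply/andP; split; apply/allP.
- by rewrite /PP all_map; apply/allP.
- rewrite /block_sums_zero /TT all_cat !all_map; apply/andP; split; apply/allP => t _ /=.
    by rewrite !big_cons big_nil addr0 addrA subrr.
  by rewrite !big_cons big_nil addr0 addrA -opprD addNr.
- rewrite /block_sums_zero /PP all_map; apply/allP => x _ /=.
  by rewrite !big_cons big_nil addr0 subrr.
Qed.

End Abelian.

(** * Half systems of odd cyclic groups *)

Lemma uniq_flatten_map (I T : eqType) (s : seq I) (F : I -> seq T) :
  uniq s -> {in s, forall i, uniq (F i)} ->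
  {in s &, forall i j, i != j -> {in F i, forall x, x \notin F j}} ->
  uniq (flatten (map F s)).
Proof.
elim: s => //= i s IH /andP[iNs us] uF dF; rewrite cat_uniq uF ?mem_head //=.
rewrite IH // => [|j js|j k js ks]; last 2 first.
- by apply: uF; rewrite inE js orbT.
- by apply: dF; rewrite inE ?js ?ks orbT.
rewrite andbT -all_predC; apply/allP => x /flattenP[_ /mapP[j js ->]] xj /=.
apply: dF xj; rewrite ?inE ?js ?eqxx ?orbT //.
by apply: contraNneq iNs => <-.
Qed.

(** The offset [h] moves the positions [a d] above the differences [d <= n]: it is [n] for (hooked)
    Skolem sequences and [n.+1] when [n.+1] must stay free. *)
Definition difference_triples (h n : nat) (a : nat -> nat) :=
  flatten [seq [:: d; h + a d; d + (h + a d)] | d <- iota 1 n].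

Lemma mem_difference_triples h n a k : k \in difference_triples h n a ->
  exists2 d, 0 < d <= n & [\/ k = d, k = h + a d | k = d + (h + a d)].
Proof.
move=> /flattenP[_ /mapP[d + ->]]; rewrite mem_iota !inE => hd kE.
exists d; first by lia.
by case/or3P: kE => /eqP ->; [constructor 1 | constructor 2 | constructor 3].
Qed.

Lemma uniq_difference_triples h n a : n <= h ->
  (forall d, 0 < d <= n -> 0 < a d) ->
  (forall d d', 0 < d <= n -> 0 < d' <= n -> d <> d' ->
    [/\ a d <> a d', a d + d <> a d' + d' & a d <> a d' + d']) ->
  uniq (difference_triples h n a).
Proof.
move=> nh a0 aU; apply: uniq_flatten_map (iota_uniq 1 n) _ _ => [d|d d'].
  by rewrite mem_iota /= !inE => hd; have := a0 d; lia.
rewrite !mem_iota => hd hd' /eqP dd' k; rewrite !inE.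
have [||? ? ?] := aU d d' _ _ dd'; try by lia.
have [||? ? ?] := aU d' d _ _ (nesym dd'); try by lia.
by have := a0 d; have := a0 d'; move=> ? ? /or3P[] /eqP ->; lia.
Qed.

Section OddCyclic.

Variable m : nat.
Notation p := (m.*2).+1.

Lemma ord_no_2torsion (x : 'I_p) : (x + x = 0)%R -> x = 0%R.
Proof.
move=> /(congr1 val) /= x2; apply: val_inj => /=.
have := ltn_ord x; have := divn_eq (x + x) p; rewrite x2.
by case: (_ %/ p) => [|[|q]]; lia.
Qed.

Lemma inZpD (k l : nat) : inZp (k + l) = (inZp k + inZp l)%R :> 'I_p.
Proof. by apply: val_inj; rewrite /= modnDm. Qed.

(** Two positive representatives below [p] have a sum less than 2p, so they are opposite only if it
    equals [p]. *)
Lemma half_system_inZp (L : seq nat) :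
  uniq L -> {in L, forall k, 0 < k < p} -> {in L &, forall k l, k + l <> p} ->
  half_system (map inZp L : seq 'I_p).
Proof.
move=> uL L0 Lp; have valL k : k \in L -> val (inZp k : 'I_p) = k.
  by move=> /L0 kp; rewrite /= modn_small; lia.
apply/half_systemP; split.
- apply/mapP => -[k kL /(congr1 val)]; rewrite valL //= => kE.
  by have := L0 k kL; rewrite -kE.
- by rewrite map_inj_in_uniq // => k l kL lL /(congr1 val); rewrite !valL.
move=> _ /mapP[k kL ->]; apply/mapP => -[l lL kl].
have : inZp (k + l) = 0%R :> 'I_p by rewrite inZpD -kl addrN.
move=> /(congr1 val) /= kl0.
have := divn_eq (k + l) p; rewrite kl0; have := L0 k kL; have := L0 l lL.
by have := Lp k l kL lL; case: (_ %/ p) => [|[|q]]; lia.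
Qed.

Lemma triple_support_difference h n a :
  triple_support [seq (inZp d, inZp (h + a d)) | d <- iota 1 n] =
  map inZp (difference_triples h n a) :> seq 'I_p.
Proof.
rewrite /triple_support /difference_triples map_flatten -!map_comp.
by congr flatten; apply: eq_map => d /=; rewrite -inZpD.
Qed.

(** The entries are at most 3n + 1 and [p] is at least 6n + 1. Two entries could add up to [p] only
    as 3n and 3n + 1, which [skolem_like] excludes. *)
Lemma half_system_triples n : 3 * n <= m ->
  exists2 T : seq ('I_p * 'I_p), size T = n & half_system (triple_support T).
Proof.
move=> nm; have [a aP] := skolem_like_exists n.
exists [seq (inZp d, inZp (n + a d)) | d <- iota 1 n]; first by rewrite size_map size_iota.
rewrite triple_support_difference; apply: half_system_inZp.
- apply: uniq_difference_triples => // [d hd|d d' hd hd' dd'].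
    by have [] := aP d d hd hd.
  by have [_ _ _ _ /(_ dd')] := aP d d' hd hd'.
- move=> k /mem_difference_triples[d hd kE].
  by have [? ? _ _ _] := aP d d hd hd; case: kE; lia.
move=> k l /mem_difference_triples[d hd kE] /mem_difference_triples[d' hd' lE].
have [? ? ? ? _] := aP d d' hd hd'; have [? ? ? ? _] := aP d' d hd' hd.
by case: kE => ->; case: lE => ->; lia.
Qed.

Lemma half_system_double_triples n : 3 * n + 3 <= m ->
  exists x : 'I_p, exists2 T : seq ('I_p * 'I_p),
    size T = n & half_system ([:: x; (x + x)%R] ++ triple_support T).
Proof.
move=> nm.
(* The differences n - 1, n - 3, ... are nested in {1, ..., n} and the differences
   n, n - 2, ... in {n + 2, ..., 2n + 2}.  With offset n + 1 the skipped position
   n + 1 becomes 2n + 2, twice the unused value n + 1. *)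
pose a d := if odd (n - d) then (n - d).+1./2 else n + 2 + (n - d)./2.
have aE d : 0 < d <= n ->
    (exists i, n - d = 2 * i + 1 /\ a d = 1 + i) \/ (exists i, n - d = 2 * i /\ a d = n + 2 + i).
  rewrite /a => hd; have := odd_double_half (n - d).
  by case: ifP => h; [left|right]; exists (n - d)./2; lia.
exists (inZp n.+1), [seq (inZp d, inZp (n.+1 + a d)) | d <- iota 1 n].
  by rewrite size_map size_iota.
rewrite triple_support_difference -inZpD.
rewrite (_ : [:: _; _] = map inZp [:: n.+1; n.+1 + n.+1]) // -map_cat.
apply: half_system_inZp.
- rewrite cat_uniq; apply/and3P; split; first by rewrite /= inE; lia.
    apply/hasPn => k /mem_difference_triples[d hd kE]; rewrite /= !inE.
    by case: (aE d hd) => -[i ?]; case: kE => ->; lia.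
  apply: uniq_difference_triples => // [d hd|d d' hd hd' dd'].
    by case: (aE d hd) => -[i ?]; lia.
  by case: (aE d hd) => -[i ?]; case: (aE d' hd') => -[i' ?]; split; lia.
- move=> k; rewrite mem_cat !inE => /orP[|/mem_difference_triples[d hd kE]]; first by lia.
  by case: (aE d hd) => -[i ?]; case: kE => ->; lia.
move=> k l; rewrite !mem_cat !inE.
move=> /orP[k2|/mem_difference_triples[d hd kE]];
move=> /orP[l2|/mem_difference_triples[d' hd' lE]]; first by lia.
- by case: (aE d' hd') => -[i ?]; case: lE => ->; lia.
- by case: (aE d hd) => -[i ?]; case: kE => ->; lia.
case: (aE d hd) => -[i ?]; case: (aE d' hd') => -[i' ?];
  by case: kE => ->; case: lE => ->; lia.
Qed.

End OddCyclic.

(** * Labellings of a parent function *)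

Section ParentFunction.

Variables (V : finType) (r : V) (par : V -> V).

(** Any total [par] is allowed, since the counts and labellings need only one parent per vertex; its
    value at [r] is discarded. *)
Definition children v := [set w | (w != r) && (par w == v)].

Lemma sum_card_children : \sum_v #|children v| = #|V|.-1.
Proof.
have -> : \sum_v #|children v| = \sum_(v : V) \sum_(w | (w != r) && (par w == v)) 1.
  by apply: eq_bigr => v _; rewrite sum1_card; apply: eq_card => w; rewrite inE.
rewrite -(partition_big par xpredT) //= sum1_card.
by rewrite (cardC1 r).
Qed.

Section Residual.

Variable pre : seq V.
Hypotheses (pre_uniq : uniq pre) (rNpre : r \notin pre).

(** The children whose labels are still free; a zero-sum block of labels will fill each of these
    sets. *)
Definition residual v := children v :\: [set:: pre].

Lemma perm_residual :
  perm_eq (r :: pre ++ flatten [seq enum (residual v) | v <- enum V]) (enum V).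
Proof.
have memF w : (w \in flatten [seq enum (residual v) | v <- enum V]) =
    (w != r) && (w \notin pre).
  apply/idP/idP => [/flattenP[_ /mapP[v _ ->]]|hw].
    by rewrite mem_enum !inE => /and3P[-> ->].
  apply/flattenP; exists (enum (residual (par w))); first by apply: map_f; rewrite mem_enum.
  by rewrite mem_enum !inE eqxx andbT andbC.
apply: uniq_perm => [||w]; rewrite ?enum_uniq //; last first.
  by rewrite mem_enum inE mem_cat memF; case: eqP => //=; case: (w \in pre).
rewrite /= mem_cat memF eqxx (negbTE rNpre) /= cat_uniq pre_uniq /=.
apply/andP; split; first by apply/hasPn => w; rewrite memF => /andP[].
apply: uniq_flatten_map => [|v _|v v' _ _ vv' w]; rewrite ?enum_uniq //.
by rewrite !mem_enum !inE => /and3P[-> -> /eqP ->]; rewrite (negbTE vv').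
Qed.

Lemma card_residual v :
  #|residual v| = #|children v| - count (fun w => par w == v) pre.
Proof.
rewrite /residual cardsD; congr (_ - _).
rewrite -size_filter -(card_uniqP (filter_uniq _ pre_uniq)).
apply: eq_card => w; rewrite !inE mem_filter andbC [RHS]andbC.
by case: (boolP (w \in pre)) => //= wpre; case: eqP rNpre => [<-|]; rewrite ?wpre.
Qed.

Lemma sum_card_residual : \sum_v #|residual v| + size pre = #|V|.-1.
Proof.
have := perm_size perm_residual; rewrite /= size_cat -cardE => <- /=.
rewrite addnC size_flatten /shape -map_comp sumnE big_map big_enum.
by congr (_ + _); apply: eq_bigr => v _ /=; rewrite -cardE.
Qed.

(* A nonempty even residual class leaves room for one more pair than the odd
   classes account for. *)
Lemma count_odd_residual : odd #|V| -> ~~ odd (size pre) ->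
  (forall v, #|residual v| != 1) ->
  exists n, count (fun v => odd #|residual v|) (enum V) = n.*2 /\
    (forall v, 6 * n + ~~ odd #|residual v| * #|residual v| + size pre <= #|V|.-1).
Proof.
move=> oV oP R1; have sE := sum_card_residual.
pose rs := [seq #|residual v| | v <- enum V].
have sumE : \sum_v #|residual v| = sumn rs by rewrite sumnE big_map big_enum.
have cE : count (fun v => odd #|residual v|) (enum V) = count odd rs by rewrite /rs count_map.
(* The classes have [#|V| - 1 - size pre] elements in all, an even number, so the number of odd
   classes is even. *)
have o2 : ~~ odd (count odd rs).
  rewrite -sumn_odd -sumE; have := congr1 odd sE; rewrite oddD (negbTE oP) addbF => ->.
  by rewrite -subn1 oddB ?oV // (leq_trans _ (max_card (pred1 r))) // card1.
exists (count odd rs)./2; rewrite cE; split; first by have := odd_double_half (count odd rs); lia.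
move=> v; rewrite -sE leq_add2r sumE.
have := odd_double_half (count odd rs); rewrite (negbTE o2) add0n.
suff : 3 * count odd rs + ~~ odd #|residual v| * #|residual v| <= sumn rs by lia.
have vP : perm_eq rs (#|residual v| :: [seq #|residual w| | w <- rem v (enum V)]).
  by rewrite -map_cons; apply/perm_map/perm_to_rem; rewrite mem_enum.
rewrite (seq.permP vP odd) (perm_sumn vP) /=.
set rs' := [seq _ | _ <- _].
have /triple_count_odd : all (fun k => k != 1) rs'.
  by rewrite all_map; apply/allP => w _; apply: R1.
by move: (R1 v); move: #|_| => k k1 le3; case: (boolP (odd k)) => /=; lia.
Qed.

Lemma sum_children_residual (G : nmodType) (g : V -> G) :
  (forall v, \sum_(w in residual v) g w = 0)%R -> forall v,
  (\sum_(w in children v) g w = \sum_(w <- pre | par w == v) g w)%R.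
Proof.
move=> R0 v; rewrite (big_setID [set:: pre]) /= R0 addr0.
rewrite -[RHS]big_filter [RHS](big_uniq _ (filter_uniq _ pre_uniq)) /=.
apply: eq_bigl => w; rewrite !inE mem_filter andbC [RHS]andbC.
by case: (boolP (w \in pre)) => //= wpre; case: eqP rNpre => [<-|]; rewrite ?wpre.
Qed.

End Residual.

(** * Labellings with no, six or four prescribed labels *)

Variable m : nat.
Hypothesis cardV : #|V| = (m.*2).+1.
Notation G := 'I_(m.*2).+1.

Lemma labelling_residual (pre : seq V) (S lab : seq G) (T : seq (G * G)) :
  uniq pre -> r \notin pre -> size pre = size lab ->
  perm_eq lab (S ++ map -%R%R S) -> half_system (S ++ triple_support T) ->
  (forall v, #|residual pre v| != 1) ->
  count (fun v => odd #|residual pre v|) (enum V) = (size T).*2 ->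
  exists g : V -> G, [/\ injective g, g r = 0%R, map g pre = lab
    & forall v, (\sum_(w in children v) g w = \sum_(w <- pre | par w == v) g w)%R].
Proof.
move=> pU rp sE labP hS R1 cR.
have [|g [gI gr gE g0]] := labelling_of_triples (@ord_no_2torsion m)
  (perm_residual pU rp) _ sE labP hS R1 cR.
  by rewrite card_ord.
by exists g; split=> //; apply: sum_children_residual.
Qed.

Lemma labelling0 : (forall v, #|children v| != 1) ->
  exists g : V -> G, [/\ injective g, g r = 0%R
    & forall v, (\sum_(w in children v) g w = 0)%R].
Proof.
move=> ch1; have R1 v : #|residual [::] v| != 1 by rewrite card_residual //= subn0.
have [||n [cn le_n]] := @count_odd_residual [::] isT isT _ _ R1; rewrite ?cardV /= ?odd_double //.
have [|T sT hT] := @half_system_triples m n; first by have := le_n r; rewrite cardV /=; lia.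
have [//||g [gI gr _ g0]] := @labelling_residual [::] [::] [::] T isT isT erefl _ hT R1.
  by rewrite cn sT.
by exists g; split=> // v; rewrite g0 big_nil.
Qed.

(** One more entry [(a, b)] of the half system supplies the six labels; its cost of six elements is
    covered by the six vertices of [pre]. *)
Lemma labelling3 x x' y y' z z' (pre := [:: x; x'; y; y'; z; z']) :
  uniq (r :: pre) -> (forall v, #|children v| - count (fun w => par w == v) pre != 1) ->
  exists g : V -> G, [/\ injective g, g r = 0%R,
    [/\ g x' = - g x, g y' = - g y, g z = g x + g y & g z' = - (g x + g y)]%R
    & forall v, (\sum_(w in children v) g w = \sum_(w <- pre | par w == v) g w)%R].
Proof.
move=> /andP[rp pU] ch1; have R1 v : #|residual pre v| != 1 by rewrite card_residual.
have [||n [cn le_n]] := @count_odd_residual pre pU rp _ _ R1; rewrite ?cardV /= ?odd_double //.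
have [|[//|[a b] T] [sT] hT] := @half_system_triples m n.+1.
  by have := le_n r; rewrite cardV /=; lia.
have [||g [gI gr gE g0]] := @labelling_residual pre [:: a; b; a + b]%R
  [:: a; - a; b; - b; a + b; - (a + b)]%R T pU rp erefl _ hT R1.
- exact: (perm_opp_pairs [:: a; b; a + b]%R).
- by rewrite cn sT.
exists g; split=> //; move: gE; rewrite /pre /= => -[-> -> -> -> -> ->].
by split.
Qed.

(** The labels a, 2a and their negatives come from [half_system_double_triples], whose bound asks
    for six more elements, while [pre] has four vertices. The nonempty even class at [v0] supplies
    the missing two. *)
Lemma labelling2 x x' y y' v0 (pre := [:: x; x'; y; y']) :
  uniq (r :: pre) -> (forall v, #|children v| - count (fun w => par w == v) pre != 1) ->
  (let k := #|children v0| - count (fun w => par w == v0) pre in ~~ odd k && (0 < k)) ->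
  exists g : V -> G, [/\ injective g, g r = 0%R,
    [/\ g x' = - g x, g y = g x + g x & g y' = - (g x + g x)]%R
    & forall v, (\sum_(w in children v) g w = \sum_(w <- pre | par w == v) g w)%R].
Proof.
move=> /andP[rp pU] ch1 ev0; have R1 v : #|residual pre v| != 1 by rewrite card_residual.
have [||n [cn le_n]] := @count_odd_residual pre pU rp _ _ R1; rewrite ?cardV /= ?odd_double //.
have [|a [T sT hT]] := @half_system_double_triples m n.
  have := le_n v0; rewrite card_residual //; case/andP: ev0 => -> /=.
  by rewrite cardV /=; clear; move: (_ - _) => k; lia.
have [||g [gI gr gE g0]] := @labelling_residual pre [:: a; a + a]%R
  [:: a; - a; a + a; - (a + a)]%R T pU rp erefl _ hT R1.
- exact: (perm_opp_pairs [:: a; a + a]%R).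
- by rewrite cn sT.
by exists g; split=> //; move: gE; rewrite /pre /= => -[-> -> -> ->].
Qed.

End ParentFunction.

(** * Rooted trees *)

Lemma edge_graceful_antimagic (V : finType) (e : rel V) : edge_graceful e -> antimagic e.
Proof.
move=> [f fL [_ fI _]]; exists f => // v w vw.
by apply: fI; rewrite ?inE // vw.
Qed.

Section Tree.

Variables (V : finType) (e : rel V).
Hypotheses (e_sym : symmetric e) (e_irr : irreflexive e) (e_tree : is_tree e).

(* cut v w deletes the edge vw; is_parent r v w says that vw is an edge with r on
   the side of v. *)
Definition cut v w : rel V := fun x y => e x y && ([set x; y] != [set v; w]).

Lemma cut_connect_sym v w : connect_sym (cut v w).
Proof. by apply: sym_connect_sym => x y; rewrite /cut e_sym setUC. Qed.

Lemma cutC v w : cut v w = cut w v.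
Proof. by rewrite /cut setUC. Qed.

Lemma edge_neq v w : e v w -> v != w.
Proof. by apply: contraTneq => ->; rewrite e_irr. Qed.

(** A simple path from [v] to [w] that avoids the edge vw has at least two edges, so that edge would
    close it to a cycle. *)
Lemma bridge v w : e v w -> ~~ connect (cut v w) v w.
Proof.
move=> evw; apply/negP => /connectP[p0 pp /esym]; case/shortenP: pp => p pp up _ pw.
have ep : path e v p by apply: sub_path pp => x y /andP[].
have /(e_tree.2) : ucycle e (v :: p).
  by rewrite /ucycle up andbT /= rcons_path ep pw e_sym.
case: p pp {up ep} pw => [|x [|y p]] //=.
  by move=> _ vw; have := edge_neq evw; rewrite vw eqxx.
by move=> /andP[/andP[_]] + _ xw; rewrite xw eqxx.
Qed.

Definition is_parent r v w := e v w && connect (cut v w) r v.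

Lemma cut_path v w x p : path e x p -> w \notin x :: p -> path (cut v w) x p.
Proof.
move=> pp wp; apply: (@sub_in_path _ (predC1 w) e) pp => [y z|].
  rewrite !inE /= => yw zw eyz; rewrite /cut eyz /=.
  by apply: contraNneq yw => /setP/(_ w); rewrite !inE eqxx orbT ![w == _]eq_sym (negbTE zw) orbF.
by apply/allP => y; apply: contraTneq => ->.
Qed.

Lemma is_parent_rcons r q w :
  path e r (rcons q w) -> uniq (r :: rcons q w) -> is_parent r (last r q) w.
Proof.
rewrite rcons_path -rcons_cons rcons_uniq => /andP[pq eqw] /andP[wq _].
by rewrite /is_parent eqw; apply/connectP; exists q => //; apply: cut_path.
Qed.

Lemma uniq_path r w : exists p, [/\ path e r p, uniq (r :: p) & last r p = w].
Proof.
have /connectP[p0 pp ->] := e_tree.1.2 r w.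
by case/shortenP: pp => p pp up _; exists p.
Qed.

Lemma is_parent_exists r w : w != r -> exists v, is_parent r v w.
Proof.
have [p [pp up pw]] := uniq_path r w.
case/lastP: p pp up pw => [_ _ /= ->|q x]; first by rewrite eqxx.
by rewrite last_rcons => pp up <- _; exists (last r q); apply: is_parent_rcons.
Qed.

Lemma is_parent_root r v : ~~ is_parent r v r.
Proof. by apply/andP => -[/bridge/negP h]; rewrite cut_connect_sym. Qed.

(** If [r] reaches [v] without the edge, it cannot also reach [w], by [bridge]. Otherwise a simple
    path from [r] to [v] passes through [w], and its part up to [w] avoids [v]. *)
Lemma is_parentC r v w : e v w -> is_parent r v w = ~~ is_parent r w v.
Proof.
move=> evw; rewrite /is_parent evw e_sym evw /= (cutC w).
case: (boolP (connect (cut v w) r v)) => rv; last first.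
  have [p [pp up pv]] := uniq_path r v.
  have [wp|/(cut_path v pp) {}pp] := boolP (w \in r :: p); last first.
    by case/negP: rv; apply/connectP; exists p; rewrite // -pv.
  case/splitPl: wp pp up pv => p1 p2 p1w; rewrite cat_path last_cat p1w.
  move=> /andP[pp1 _] up p2v; apply/esym/negbF; rewrite cutC; apply/connectP.
  exists p1 => //; apply: cut_path => //; apply/negP => vp1.
  case: p2 p2v up => [/= wv|x p2 p2v]; first by have := edge_neq evw; rewrite wv eqxx.
  have vp2 : v \in x :: p2 by rewrite -p2v; apply: (mem_last x p2).
  by rewrite -cat_cons cat_uniq => /and3P[_ /hasPn/(_ v vp2)]; rewrite /= vp1.
apply/esym/negP => rw; case/negP: (bridge evw).
by rewrite (connect_trans _ rw) // cut_connect_sym.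
Qed.

(** If [v] and [v'] differed, [r] would reach [v] without meeting [w], then [w] along vw, hence
    without the edge v'w; as it also reaches [v'] without that edge, this contradicts [bridge]. *)
Lemma is_parent_uniq r v v' w : is_parent r v w -> is_parent r v' w -> v = v'.
Proof.
move=> /andP[evw rv] /andP[ev'w rv']; apply/eqP; apply: contraT => vv'.
have /connectP[p pp pv] := rv.
have [wp|wp] := boolP (w \in r :: p).
  case/negP: (bridge evw); rewrite cut_connect_sym in rv.
  exact: connect_trans rv (path_connect pp wp).
case/negP: (bridge ev'w); rewrite cut_connect_sym in rv'.
apply: connect_trans rv' _; rewrite cutC.
have ep : path e r p by apply: sub_path pp => x y /andP[].
apply: (@connect_trans _ _ v).
  by apply/connectP; exists p => //; rewrite cutC; apply: cut_path.
apply: connect1; rewrite /cut evw /=; apply: contraNneq vv' => /setP/(_ v).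
by rewrite !inE eqxx (negbTE (edge_neq evw)) /= => /esym.
Qed.

Definition par r w := odflt r [pick v | is_parent r v w].

Lemma parP r w : w != r -> is_parent r (par r w) w.
Proof.
move=> wr; rewrite /par; case: pickP => [//|no].
by have [v] := is_parent_exists wr; rewrite no.
Qed.

Lemma is_parentE r v w : is_parent r v w = (w != r) && (par r w == v).
Proof.
apply/idP/andP => [vw|[/parP h /eqP <-]//].
have wr : w != r by apply: contraTneq vw => ->; apply: is_parent_root.
by split=> //; apply/eqP/(is_parent_uniq (parP wr)).
Qed.

Lemma childrenE r v : children r (par r) v = [set w | is_parent r v w].
Proof. by apply/setP => w; rewrite !inE is_parentE. Qed.

Lemma par_edge r w : w != r -> e (par r w) w.
Proof. by move/parP/andP => []. Qed.

Lemma par_child r v w : e v w -> (par r w == v) && (w != r) = ~~ ((par r v == w) && (v != r)).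
Proof. by move=> /(is_parentC r); rewrite !is_parentE ![_ && (_ == _)]andbC. Qed.

Lemma degreeE r v : degree e v = #|children r (par r) v| + (v != r).
Proof.
rewrite /degree childrenE.
rewrite -(cardsID [set w | is_parent r v w]); congr (_ + _).
  by apply: eq_card => w; rewrite !inE andbC; case: (boolP (is_parent r v w)) => // /andP[].
case: (eqVneq v r) => [->|vr] /=.
  apply: eq_card0 => w; rewrite !inE; apply/negP => /andP[nw ew].
  by case/negP: nw; rewrite (is_parentC r ew) is_parent_root.
rewrite -(cards1 (par r v)); apply: eq_card => w; rewrite !inE.
apply/andP/eqP => [[nw ew]|->].
  have := is_parentC r ew; rewrite (negbTE nw) => /esym/negbFE.
  by rewrite is_parentE => /andP[_ /eqP].
have h := par_edge vr; rewrite e_sym h; split=> //.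
by have := is_parentC r h; rewrite parP // => /esym.
Qed.

(** The edge between [r] and [r'] misses [w], so cutting the edge from [w] to its parent leaves [r]
    and [r'] connected. *)
Lemma par_adjacent_root r r' w : e r r' -> w != r -> w != r' -> par r' w = par r w.
Proof.
move=> err' wr wr'; have /andP[epw cp] := parP wr.
have : is_parent r' (par r w) w.
  rewrite /is_parent epw /=; apply: connect_trans cp; apply: connect1.
  rewrite /cut e_sym err' /=; apply/eqP => /setP/(_ w); rewrite !inE eqxx orbT.
  by rewrite (negbTE wr) (negbTE wr').
by rewrite is_parentE => /andP[_ /eqP].
Qed.

(** Walk from a vertex satisfying [P] towards the root while the parent satisfies [P]; the root does
    not, so the walk stops. *)
Lemma par_first r (P : pred V) : ~~ P r -> (exists v, P v) ->
  exists v, [/\ P v, v != r & ~~ P (par r v)].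
Proof.
move=> Pr [v Pv]; have [p [pp up pv]] := uniq_path r v.
elim/last_ind: p v Pv pp up pv => [v Pv _ _ /= rv|p x IH v Pv pp up].
  by move: Pr; rewrite rv Pv.
rewrite last_rcons => xv; have := is_parent_rcons pp up; rewrite is_parentE => /andP[xr /eqP xp].
have [Pl|Pl] := boolP (P (last r p)); last by exists x; rewrite xp xv in xr *.
move: pp up; rewrite rcons_path -rcons_cons rcons_uniq => /andP[pp _] /andP[_ up].
exact: IH Pl pp up erefl.
Qed.

Lemma par_neq r w : w != r -> par r w != w.
Proof. by move/par_edge/edge_neq. Qed.

(** * From vertex labels to edge-graceful labellings *)

Variable m : nat.
Hypothesis cardV : #|V| = (m.*2).+1.
Notation G := 'I_(m.*2).+1.

(** The degree sum is 2(p - 1), so the vertices of odd degree are even in number, and p is odd. *)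
Lemma odd_card_even_degree : odd #|[set v | ~~ odd (degree e v)]|.
Proof.
have /card_gt0P[r _] : 0 < #|V| by rewrite cardV.
have : ~~ odd (\sum_v degree e v).
  rewrite (eq_bigr (fun v => #|children r (par r) v| + (v != r))); last first.
    by move=> v _; apply: degreeE.
  rewrite big_split /= sum_card_children -(big_mkcond (fun v => v != r) (fun=> 1)) sum1_card.
  by rewrite (cardC1 r) addnn odd_double.
have -> : odd (\sum_v degree e v) = odd #|[set v | odd (degree e v)]|.
  rewrite -sum1_card [in RHS]big_mkcond /=; elim/big_rec2: _ => // v k l _ kl.
  by rewrite inE oddD kl; case: (odd (degree e v)).
have -> : [set v | odd (degree e v)] = ~: [set v | ~~ odd (degree e v)].
  by apply/setP => v; rewrite !inE negbK.
have := cardsC [set v | ~~ odd (degree e v)]; rewrite cardV.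
by move: #|_| #|_|; lia.
Qed.

(* The edge from w to its parent gets the residue g w. *)
Lemma edge_graceful_of_vertex_labelling r (g : V -> G) : injective g -> g r = 0%R ->
  injective (fun v => (g v + \sum_(w in children r (par r) v) g w)%R) -> edge_graceful e.
Proof.
move=> gI gr sI.
pose E w := [set par r w; w].
(* Two distinct vertices with the same edge to the parent would be parents of each other. *)
have EI : {in [set~ r] &, injective E}.
  move=> w w'; rewrite !inE => wr w'r; rewrite /E => EE.
  have := congr1 (fun A : {set V} => w \in A) EE.
  rewrite !inE eqxx orbT => /esym/orP[/eqP ww'|/eqP//].
  have := congr1 (fun A : {set V} => w' \in A) EE.
  rewrite !inE eqxx orbT => /orP[/eqP w'w|/eqP//].
  have := is_parentC r (par_edge wr); rewrite (parP wr) -w'w => /esym.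
  by rewrite is_parentE w'r -ww' eqxx.
have EE : edges e = E @: [set~ r].
  apply/setP => A; apply/imset2P/imsetP => [[x y _]|[w]]; rewrite !inE.
    move=> exy ->; case: (boolP (is_parent r x y)).
      by rewrite is_parentE => /andP[yr /eqP <-]; exists y; rewrite ?inE.
    rewrite (is_parentC r exy) negbK is_parentE => /andP[xr /eqP <-].
    by exists x; rewrite ?inE // /E setUC.
  by move=> wr ->; exists (par r w) w; rewrite ?inE ?par_edge.
have cE : #|edges e| = m.*2 by rewrite EE card_in_imset // cardsC1 cardV.
(* For an edge [A] the sum has exactly one term, so it reads off the label of the [w] with
   [A = E w]. *)
pose f A : nat := \sum_(w | (w != r) && (A == E w)) g w.
have fE w : w != r -> f (E w) = g w.
  move=> wr; rewrite /f (big_pred1 w) // => w'.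
  apply/andP/eqP => [[w'r /eqP/EI->]//|->]; rewrite ?inE //.
have gB : bijective g by apply: inj_card_bij => //; rewrite card_ord cardV.
(* The root holds the residue 0; the others, read as integers, are exactly the labels 1, ..., p -
   1. *)
have g0 w : w != r -> 0 < g w.
  move=> wr; rewrite lt0n; apply: contra wr => /eqP gw.
  by apply/eqP/gI; rewrite gr; apply: val_inj.
exists f.
  split.
  - rewrite EE => _ /imsetP[w + ->]; rewrite !inE -EE cE => wr.
    by rewrite fE // g0 //= -ltnS ltn_ord.
  - rewrite EE => _ _ /imsetP[w + ->] /imsetP[w' + ->]; rewrite !inE => wr w'r.
    by rewrite !fE // => /val_inj/gI ->.
  move=> k; rewrite cE => /andP[k0 km]; have [h _ gh] := gB.
  have kr : h (inord k) != r.
    apply: contraTneq k0 => hr; have := congr1 val (gh (inord k)).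
    by rewrite hr gr /= inordK // => <-.
  by exists (E (h (inord k))); rewrite ?EE ?imset_f ?inE // fE // gh inordK.
(* The edge to the parent contributes [g v]; the root has no such edge, in accordance with
   [g r = 0]. *)
have sumE v : (inZp (vertex_sum e f v) : G) = (g v + \sum_(w in children r (par r) v) g w)%R.
  have -> : vertex_sum e f v = g v + \sum_(w in children r (par r) v) g w.
    rewrite /vertex_sum EE big_mkcondr big_imset //= -big_mkcondr.
    rewrite (eq_bigr (fun w => val (g w))); last by move=> w; rewrite !inE => /andP[/fE].
    rewrite (bigID (pred1 v)) /=; congr (_ + _); last first.
      apply: eq_bigl => w; rewrite !inE; case: (boolP (w == r)) => //= wr.
      case: (eqVneq w v) wr => [-> vr|wv _]; last by rewrite andbT orbF eq_sym.
      by rewrite andbF; apply/esym/negbTE/par_neq.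
    case: (eqVneq v r) => [->|vr].
      rewrite gr big_pred0 // => w; rewrite !inE.
      by case: (eqVneq w r) => //=; rewrite andbF.
    rewrite (big_pred1 v) // => w; rewrite !inE.
    by case: (eqVneq w v) => [->|_]; rewrite ?andbF // vr orbT.
  rewrite inZpD valZpK; congr (_ + _)%R.
  rewrite (big_morph inZp (@inZpD m) (_ : inZp 0 = 0%R)); last exact: val_inj.
  by apply: eq_bigr => w _; rewrite valZpK.
have sB : bijective (fun v => (g v + \sum_(w in children r (par r) v) g w)%R : G).
  by apply: inj_card_bij => //; rewrite card_ord cardV.
rewrite cardV; split.
- by move=> v _; rewrite ltn_mod.
- move=> v w _ _ vw; apply: sI => /=; rewrite -!sumE; exact: val_inj.
move=> k kp; have [h _ sh] := sB.
by exists (h (Ordinal kp)); rewrite ?inE //; have := congr1 val (sh (Ordinal kp)); rewrite -sumE.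
Qed.

(** * Degree-two vertices *)

(** A transposition keeps distinct labels distinct; [a = b] covers the case without an exchange. *)
Lemma edge_graceful_of_swap r (g : V -> G) a b : injective g -> g r = 0%R ->
  (forall v, g v + \sum_(w in children r (par r) v) g w = g (tperm a b v))%R ->
  edge_graceful e.
Proof.
move=> gI gr gs; apply: (edge_graceful_of_vertex_labelling gI gr) => v w.
by rewrite !gs => /gI/perm_inj.
Qed.

Lemma oppr_triple (Z : zmodType) (x y : Z) : (- x + (- y + (x + y)) = 0)%R.
Proof. by rewrite addrA -opprD addNr. Qed.

Lemma neq_of_par r p q x y : par r x = p -> par r y = q -> p != q -> x != y.
Proof. by move=> <- <-; apply: contra_neq => ->. Qed.

Lemma children_neq1 r v : v != r -> degree e v != 2 -> #|children r (par r) v| != 1.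
Proof. by move=> vr; rewrite (degreeE r) vr; lia. Qed.

Lemma children_root_gt0 r : 1 < #|V| -> 0 < #|children r (par r) r|.
Proof.
move=> /card_gt1P[x [y [_ _ xy]]].
have [||v [_ vr pv]] := @par_first r (predC1 r); first by rewrite /= eqxx.
  case: (eqVneq x r) xy => [<- xy|xr _]; first by exists y; rewrite /= eq_sym.
  by exists x.
by apply/card_gt0P; exists v; rewrite inE vr; apply: contraNT pv.
Qed.

(** The root is the vertex of degree two, which then has two children, or in its absence a vertex of
    even degree. Any other vertex has exactly one child only if its degree is two. *)
Lemma edge_graceful_one_deg2 : #|[set v | degree e v == 2]| <= 1 -> edge_graceful e.
Proof.
move=> le1; have [r rP] : exists r, forall v, #|children r (par r) v| != 1.
  have [|[r]] := set_0Vmem [set v | degree e v == 2].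
    move=> /setP no2; have : 0 < #|[set v | ~~ odd (degree e v)]|.
      by move: odd_card_even_degree; case: #|_|.
    case/card_gt0P => r; rewrite inE => or; exists r => v.
    case: (eqVneq v r) => [->|vr]; last first.
      by apply: children_neq1 => //; have := no2 v; rewrite !inE => ->.
    by move: or; rewrite (degreeE r) eqxx addn0; case: eqP => // ->.
  rewrite inE => /eqP r2; exists r => v; case: (eqVneq v r) => [->|vr].
    by move: r2; rewrite (degreeE r) eqxx addn0 => ->.
  apply: children_neq1 => //; apply: contraNneq vr => v2.
  by apply/eqP/(card_le1_eqP le1); rewrite inE ?v2 ?r2.
have [g [gI gr gs]] := labelling0 cardV rP.
apply: (edge_graceful_of_swap (a := r) (b := r) gI gr) => v.
by rewrite gs addr0 tperm1 perm1.
Qed.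

Lemma childrenP r v x :
  reflect (x != r /\ par r x = v) (x \in children r (par r) v).
Proof. by rewrite inE; apply: (iffP andP) => -[? /eqP]. Qed.

Lemma par_adjacent r w : e r w -> par r w = r.
Proof. by move/(par_child r); rewrite eqxx andbF => /andP[/eqP]. Qed.

(** * Trees with exactly two vertices of degree two *)

Section TwoDeg2.

Variables (u w : V).
Hypotheses (u_w : u != w) (u2 : degree e u = 2) (w2 : degree e w = 2).
Hypothesis deg2 : forall v, v != u -> v != w -> degree e v != 2.

Let card_gt1 : 1 < #|V|.
Proof. by apply/card_gt1P; exists u, w. Qed.

Lemma third_even_degree : exists t, [/\ ~~ odd (degree e t), t != u & t != w].
Proof.
have : ~~ ([set v | ~~ odd (degree e v)] \subset [set u; w]).
  apply/negP => sub; move: odd_card_even_degree.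
  suff -> : [set v | ~~ odd (degree e v)] = [set u; w] by rewrite cards2 u_w.
  apply/eqP; rewrite eqEsubset sub; apply/subsetP => v.
  by rewrite !inE => /orP[] /eqP ->; rewrite ?u2 ?w2.
by move=> /subsetPn[t]; rewrite !inE negb_or => ot /andP[tu tw]; exists t.
Qed.

Ltac neq :=
  match goal with
  | H : is_true (?x != ?y) |- is_true (?x != ?y) => exact: H
  | H : is_true (?y != ?x) |- is_true (?x != ?y) => rewrite eq_sym; exact: H
  | Hx : par _ ?x = ?p, Hy : par _ ?y = ?q, H : is_true (?p != ?q) |- is_true (?x != ?y) =>
      exact: (neq_of_par Hx Hy H)
  | Hx : par _ ?x = ?p, Hy : par _ ?y = ?q, H : is_true (?q != ?p) |- is_true (?x != ?y) =>
      rewrite eq_sym; exact: (neq_of_par Hy Hx H)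
  end.

Ltac neqs := rewrite /= ?inE ?negb_or ?andbT -?andbA; repeat (apply/andP; split); neq.

(* Root u, with child c of w and children a, b of u: g c = - g w and
   g a + g b = g w exchange the sums at u and w. *)
Lemma edge_graceful_even_parent :
  ~~ e u w -> ~~ odd (degree e (par u w)) -> edge_graceful e.
Proof.
move=> nadj oy; have wu : w != u by rewrite eq_sym.
have [y pw] : exists y, par u w = y by exists (par u w).
have yw := par_neq wu; have := par_edge wu; rewrite pw in oy yw *; move=> eyw.
have yu : y != u by apply: contraNneq nadj => <-.
have nu : #|children u (par u) u| = 2 by move: u2; rewrite (degreeE u) eqxx addn0.
have nw : #|children u (par u) w| = 1 by move: w2; rewrite (degreeE u) wu addn1 => -[].
have ny : odd #|children u (par u) y| /\ 2 < #|children u (par u) y|.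
  by move: oy (deg2 yu yw); rewrite (degreeE u) yu; move: #|_| => k; clear; lia.
have /eqP/cards2P[a [b [ab chu]]] := nu.
have /eqP/cards1P[c chw] := nw.
(* Two siblings [d1], [d2] of [w] will carry [- g a] and [- g b], which cancel [g w] in the sum at
   [y]. *)
have : 1 < #|children u (par u) y :\ w|.
  have := cardsD1 w (children u (par u) y).
  rewrite inE wu pw eqxx; case: ny; move: #|_| #|_| => k l; clear; lia.
case/card_gt1P => d1 [d2 []].
move=> /setD1P[d1w /childrenP[d1u pd1]] /setD1P[d2w /childrenP[d2u pd2]] d12.
have /childrenP[au pa] : a \in children u (par u) u by rewrite chu !inE eqxx.
have /childrenP[bu pb] : b \in children u (par u) u by rewrite chu !inE eqxx orbT.
have /childrenP[cu pc] : c \in children u (par u) w by rewrite chw inE.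
have [||g [gI gr [gd1 gd2 gw gc] gs]] := @labelling3 V u (par u) m cardV a d1 b d2 w c.
- neqs.
- move=> v /=; rewrite pa pb pc pd1 pd2 pw.
  case: (eqVneq u v) => [<-|uv]; first by rewrite nu (negbTE yu) (negbTE wu).
  case: (eqVneq w v) => [<-|wv]; first by rewrite nw (negbTE yw).
  case: (eqVneq y v) => [<-|yv]; first by case: ny; move: #|_| => k; clear; lia.
  by rewrite !addn0 subn0; apply: children_neq1; [|apply: deg2]; rewrite eq_sym.
apply: (edge_graceful_of_swap (a := u) (b := w) gI gr) => v.
rewrite gs !big_cons big_nil pa pb pc pd1 pd2 pw gd1 gd2 gc gw.
case: (eqVneq u v) => [<-|uv].
  by rewrite (negbTE yu) (negbTE wu) tpermL gr gw add0r addr0.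
case: (eqVneq w v) => [<-|wv].
  by rewrite (negbTE yw) tpermR gr gw addr0 subrr.
rewrite (tpermD uv wv); case: (y == v); last exact: addr0.
by rewrite (addr0 (_ + _)%R) oppr_triple addr0.
Qed.

(* With children a of u and b of w: g b = - g a and g w = g a + g u exchange the
   sums at u and w.  If u and w are the only two siblings of their class, then
   g w = - g u forces g a = 2 g w. *)
Lemma edge_graceful_even_root r :
  ~~ e u w -> u != r -> w != r -> ~~ odd (degree e r) ->
  (par r u == r) || odd (degree e (par r u)) ->
  (par r w == r) || odd (degree e (par r w)) -> edge_graceful e.
Proof.
move=> nadj ur wr or oP oQ; have wu : w != u by rewrite eq_sym.
have even_children v : (v == r) || odd (degree e v) -> ~~ odd #|children r (par r) v|.
  case: (eqVneq v r) => [-> _|vr /=]; first by move: or; rewrite (degreeE r) eqxx addn0.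
  by rewrite (degreeE r) vr addn1 /=.
have [P pu] : exists P, par r u = P by exists (par r u).
have [Q pw] : exists Q, par r w = Q by exists (par r w).
have Pu := par_neq ur; have Qw := par_neq wr.
have ePu := par_edge ur; have eQw := par_edge wr.
move/even_children: oP => oP; move/even_children: oQ => oQ.
rewrite pu pw in oP oQ Pu Qw ePu eQw.
have Pw : P != w by apply: contraNneq nadj => <-; rewrite e_sym.
have Qu : Q != u by apply: contraNneq nadj => <-.
have nu : #|children r (par r) u| = 1 by move: u2; rewrite (degreeE r) ur addn1 => -[].
have nw : #|children r (par r) w| = 1 by move: w2; rewrite (degreeE r) wr addn1 => -[].
have /eqP/cards1P[a chu] := nu; have /eqP/cards1P[b chw] := nw.
have /childrenP[ar pa] : a \in children r (par r) u by rewrite chu inE.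
have /childrenP[br pb] : b \in children r (par r) w by rewrite chw inE.
have uP : u \in children r (par r) P by apply/childrenP.
have wQ : w \in children r (par r) Q by apply/childrenP.
have odd_neq1 v : u != v -> w != v -> odd #|children r (par r) v| ->
    [/\ P != v, Q != v & #|children r (par r) v| != 1].
  move=> uv wv ov; split; try by apply: contraTneq ov => <-.
  apply: children_neq1; last by apply: deg2; rewrite eq_sym.
  by apply: contraTneq ov => ->; apply: even_children; rewrite eqxx.
(* The siblings [u'] and [w'] will carry [- g u] and [- g w]. The classes of [u] and [w] are even,
   so spare siblings exist unless [u] and [w] form a class by themselves. *)
have [[u' [w' [[u'r pu'] [w'r pw'] u'u u'w [w'u w'w u'w']]]]|[PQ chP]] :
    (exists u' w', [/\ u' != r /\ par r u' = P, w' != r /\ par r w' = Q,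
      u' != u, u' != w & [/\ w' != u, w' != w & u' != w']]) \/
    (P = Q /\ children r (par r) P = [set u; w]).
- case: (eqVneq P Q) => [PQ|PQ].
    have sub : [set u; w] \subset children r (par r) P.
      by apply/subsetP => x; rewrite in_set2 => /orP[] /eqP ->; rewrite // PQ.
    have [le2|gt2] := leqP #|children r (par r) P| 2.
      by right; split=> //; apply/esym/eqP; rewrite eqEcard sub cards2 u_w.
    have : 1 < #|children r (par r) P :\ u :\ w|.
      have := cardsD1 u (children r (par r) P); have := cardsD1 w (children r (par r) P :\ u).
      rewrite uP in_setD1 wu {2}PQ wQ /=.
      by move: oP gt2; move: #|_| #|_| #|_| => j k l; clear; lia.
    case/card_gt1P => u' [w' [/setD1P[u'w /setD1P[u'u /childrenP u'P]]]].
    move=> /setD1P[w'w /setD1P[w'u /childrenP w'P]] u'w'; left; exists u', w'.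
    by rewrite -PQ.
  have mate v x : x \in children r (par r) v -> ~~ odd #|children r (par r) v| ->
      exists x', [/\ x' != r, par r x' = v & x' != x].
    move=> xv ov; have : 0 < #|children r (par r) v :\ x|.
      by move: ov; rewrite (cardsD1 x) xv; case: #|_|.
    by case/card_gt0P => x' /setD1P[x'x /childrenP[]]; exists x'.
  have [u' [u'r pu' u'u]] := mate _ _ uP oP; have [w' [w'r pw' w'w]] := mate _ _ wQ oQ.
  by left; exists u', w'; split=> //; [neq | split; neq].
- have [||g [gI gr [gb gu' gw gw'] gs]] := @labelling3 V r (par r) m cardV a b u u' w w'.
  + neqs.
  + move=> v /=; rewrite pa pb pu pu' pw pw'.
    case: (eqVneq u v) => [<-|uv]; first by rewrite nu (negbTE Pu) (negbTE Qu) (negbTE wu).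
    case: (eqVneq w v) => [<-|wv]; first by rewrite nw (negbTE Pw) (negbTE Qw).
    have [/(odd_neq1 v uv wv)[Pv Qv v1]|] := boolP (odd #|children r (par r) v|).
      by rewrite (negbTE Pv) (negbTE Qv) subn0.
    by move: #|_| (P == v) (Q == v) => k i j; clear; lia.
  apply: (edge_graceful_of_swap (a := u) (b := w) gI gr) => v.
  rewrite gs !big_cons big_nil pa pb pu pu' pw pw' gb gu' gw gw'.
  case: (eqVneq u v) => [<-|uv].
    by rewrite (negbTE Pu) (negbTE Qu) (negbTE wu) tpermL gw addr0 addrC.
  case: (eqVneq w v) => [<-|wv].
    by rewrite (negbTE Pw) (negbTE Qw) tpermR gw addr0 addrAC subrr add0r.
  rewrite (tpermD uv wv); case: (P == v); case: (Q == v);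
    by rewrite ?addr0 ?subrr ?addr0 ?subrr ?addr0.
(* The class of the root then contains none of the four prescribed vertices; even and nonempty, it
   is the class required by [labelling2]. *)
have Pr : P != r.
  apply/eqP => Pr; rewrite {}Pr in chP.
  have : degree e r = 2 by rewrite (degreeE r) chP cards2 u_w eqxx.
  by apply/eqP/deg2; rewrite eq_sym.
have [|||g [gI gr [gu ga gb] gs]] := @labelling2 V r (par r) m cardV w u a b r.
- rewrite PQ in pu *; neqs.
- move=> v /=; rewrite pa pb pu pw -PQ.
  case: (eqVneq u v) => [<-|uv]; first by rewrite nu (negbTE Pu) (negbTE wu).
  case: (eqVneq w v) => [<-|wv]; first by rewrite nw (negbTE Pw).
  have [/(odd_neq1 v uv wv)[Pv _ v1]|] := boolP (odd #|children r (par r) v|).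
    by rewrite (negbTE Pv) subn0.
  by move: #|_| (P == v) => k i; clear; lia.
- rewrite /= pa pb pu pw -PQ (negbTE Pr) (negbTE ur) (negbTE wr) subn0.
  by rewrite even_children ?eqxx // children_root_gt0.
apply: (edge_graceful_of_swap (a := u) (b := w) gI gr) => v.
rewrite gs !big_cons big_nil pa pb pu pw -PQ gu ga gb.
case: (eqVneq u v) => [<-|uv].
  by rewrite (negbTE Pu) (negbTE wu) tpermL gu addr0 addKr.
case: (eqVneq w v) => [<-|wv].
  by rewrite (negbTE Pw) tpermR gu addr0 opprD addrA subrr add0r.
by rewrite (tpermD uv wv); case: (P == v); rewrite ?addr0 ?subrr ?addr0.
Qed.

(* Root u, with children b, w of u and c of w: g w = - g b, g c = 2 g b and the
   children of b summing to - g c exchange the sums at w and b. *)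
Lemma edge_graceful_adjacent_even b :
  e u w -> e u b -> b != w -> ~~ odd (degree e b) -> edge_graceful e.
Proof.
move=> euw eub bw ob; have wu : w != u by rewrite eq_sym.
have bu : b != u by rewrite eq_sym edge_neq.
have pw := par_adjacent euw; have pb := par_adjacent eub.
have nu : #|children u (par u) u| = 2 by move: u2; rewrite (degreeE u) eqxx addn0.
have nw : #|children u (par u) w| = 1 by move: w2; rewrite (degreeE u) wu addn1 => -[].
have nb : odd #|children u (par u) b| /\ 2 < #|children u (par u) b|.
  by move: ob (deg2 bu bw); rewrite (degreeE u) bu; move: #|_| => k; clear; lia.
have /eqP/cards1P[c chw] := nw.
have /childrenP[cu pc] : c \in children u (par u) w by rewrite chw inE.
have /card_gt0P[c' /childrenP[c'u pc']] : 0 < #|children u (par u) b| by case: nb; case: #|_|.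
(* Besides [c'], an even positive number of children of [b] remains, so [b] itself can serve as
   [v0]. *)
have [|||g [gI gr [gw gc gc'] gs]] := @labelling2 V u (par u) m cardV b w c c' b.
- neqs.
- move=> v /=; rewrite pb pw pc pc'.
  case: (eqVneq u v) => [<-|uv]; first by rewrite nu (negbTE bu) (negbTE wu).
  case: (eqVneq w v) => [<-|wv]; first by rewrite nw (negbTE bw).
  case: (eqVneq b v) => [<-|bv]; first by case: nb; move: #|_| => k; clear; lia.
  by rewrite !addn0 subn0; apply: children_neq1; [|apply: deg2]; rewrite eq_sym.
- rewrite /= pb pw pc pc' eqxx [u == b]eq_sym [w == b]eq_sym (negbTE bu) (negbTE bw).
  by case: nb; move: #|_| => k; clear; lia.
apply: (edge_graceful_of_swap (a := w) (b := b) gI gr) => v.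
rewrite gs !big_cons big_nil pb pw pc pc' gw gc gc'.
case: (eqVneq w v) => [<-|wv].
  by rewrite (negbTE u_w) (negbTE bw) tpermL gw addr0 addKr.
case: (eqVneq b v) => [<-|bv].
  by rewrite [u == b]eq_sym (negbTE bu) tpermR gw addr0 opprD addrA subrr add0r.
by rewrite (tpermD wv bv); case: (u == v); rewrite ?addr0 ?subrr ?addr0.
Qed.

(* Root u, with children b, w of u and c of w, and t of even degree whose parent
   has odd degree: g b = - g w, g t = g w + g c and the children of t summing to
   - g c exchange the sums at w and t. *)
Lemma edge_graceful_adjacent_odd : e u w ->
  (forall b, e u b -> b != w -> odd (degree e b)) ->
  (forall c, e w c -> c != u -> odd (degree e c)) -> edge_graceful e.
Proof.
move=> euw u_odd w_odd; have wu : w != u by rewrite eq_sym.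
have pw := par_adjacent euw.
have nu : #|children u (par u) u| = 2 by move: u2; rewrite (degreeE u) eqxx addn0.
have nw : #|children u (par u) w| = 1 by move: w2; rewrite (degreeE u) wu addn1 => -[].
have /card_gt0P[b /setD1P[bw /childrenP[bu pb]]] : 0 < #|children u (par u) u :\ w|.
  by move: nu; rewrite (cardsD1 w) inE wu pw eqxx; case: #|_|.
have /eqP/cards1P[c chw] := nw.
have /childrenP[cu pc] : c \in children u (par u) w by rewrite chw inE.
have [t0 [ot0 t0u t0w]] := third_even_degree.
(* The parent of this [t] is [u], [w] or of odd degree; the first two are impossible, since the
   other neighbours of [u] and [w] have odd degree. *)
have [||t [/and3P[ot tu tw] _]] :=
    @par_first u (fun v => [&& ~~ odd (degree e v), v != u & v != w]).
- by rewrite eqxx andbF.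
- by exists t0; rewrite ot0 t0u.
have [q pt] : exists q, par u t = q by exists (par u t).
have eqt := par_edge tu; have qt := par_neq tu; rewrite pt in eqt qt *.
have qu : q != u.
  by apply: contraNneq ot => qu; apply: u_odd; rewrite // -qu.
have qw : q != w.
  by apply: contraNneq ot => qw; apply: w_odd; rewrite // -qw.
rewrite qu qw !andbT negbK => oq.
have nq : ~~ odd #|children u (par u) q| by move: oq; rewrite (degreeE u) qu addn1.
have nt : odd #|children u (par u) t| /\ 2 < #|children u (par u) t|.
  by move: ot (deg2 tu tw); rewrite (degreeE u) tu; move: #|_| => k; clear; lia.
have /card_gt0P[c' /childrenP[c'u pc']] : 0 < #|children u (par u) t| by case: nt; case: #|_|.
(* The number of children of [q] is even, so [t] has a sibling [t'] to carry [- g t]. *)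
have /card_gt0P[t' /setD1P[t't /childrenP[t'u pt']]] : 0 < #|children u (par u) q :\ t|.
  by move: nq; rewrite (cardsD1 t) inE tu pt eqxx; case: #|_|.
have [||g [gI gr [gb gc' gt gt'] gs]] := @labelling3 V u (par u) m cardV w b c c' t t'.
- neqs.
- move=> v /=; rewrite pb pw pc pc' pt pt'.
  case: (eqVneq u v) => [<-|uv]; first by rewrite nu (negbTE wu) (negbTE tu) (negbTE qu).
  case: (eqVneq w v) => [<-|wv]; first by rewrite nw (negbTE tw) (negbTE qw).
  case: (eqVneq t v) => [<-|tv].
    by rewrite (negbTE qt); case: nt; move: #|_| => k; clear; lia.
  case: (eqVneq q v) => [<-|qv]; first by move: nq; move: #|_| => k; clear; lia.
  by rewrite !addn0 subn0; apply: children_neq1; [|apply: deg2]; rewrite eq_sym.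
apply: (edge_graceful_of_swap (a := w) (b := t) gI gr) => v.
rewrite gs !big_cons big_nil pb pw pc pc' pt pt' gb gc' gt gt'.
case: (eqVneq w v) => [<-|wv].
  by rewrite (negbTE u_w) (negbTE tw) (negbTE qw) tpermL gt addr0.
case: (eqVneq t v) => [<-|tv].
  by rewrite [u == t]eq_sym (negbTE tu) (negbTE qt) tpermR gt addr0 addrK.
by rewrite (tpermD wv tv); case: (u == v); case: (q == v);
  rewrite ?addr0 ?subrr ?addr0 ?subrr ?addr0.
Qed.

End TwoDeg2.

(** For nonadjacent [u] and [w], root at one of them if this gives the other a parent of even
    degree; if not, root at a neighbour of [u] or [w] of even degree, and failing that at a third
    vertex of even degree. *)
Lemma edge_graceful_two_deg2 u w :
  u != w -> degree e u = 2 -> degree e w = 2 ->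
  (forall v, v != u -> v != w -> degree e v != 2) -> edge_graceful e.
Proof.
move=> uw u2 w2 deg2; have wu : w != u by rewrite eq_sym.
have deg2' v : v != w -> v != u -> degree e v != 2 by move=> vw vu; apply: deg2.
have [euw|nuw] := boolP (e u w).
  have ewu : e w u by rewrite e_sym.
  have [/existsP[b /and3P[]]|/existsPn u_odd] :=
      boolP [exists b, [&& e u b, b != w & ~~ odd (degree e b)]].
    exact: edge_graceful_adjacent_even.
  have [/existsP[c /and3P[]]|/existsPn w_odd] :=
      boolP [exists c, [&& e w c, c != u & ~~ odd (degree e c)]].
    exact: edge_graceful_adjacent_even.
  apply: (edge_graceful_adjacent_odd uw u2 w2 deg2 euw) => [b eub bw|c ewc cu].
    by have := u_odd b; rewrite eub bw negbK.
  by have := w_odd c; rewrite ewc cu negbK.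
have nwu : ~~ e w u by rewrite e_sym.
have [puw|puw] := boolP (odd (degree e (par u w))); last exact: edge_graceful_even_parent puw.
have [pwu|pwu] := boolP (odd (degree e (par w u))); last exact: edge_graceful_even_parent pwu.
have [/existsP[b /andP[eub ob]]|/existsPn u_odd] :=
    boolP [exists b, e u b && ~~ odd (degree e b)].
  have wb : w != b by apply: contraNneq nuw => ->.
  apply: (edge_graceful_even_root uw u2 w2 deg2 nuw (edge_neq eub) wb ob).
    by rewrite par_adjacent ?eqxx // e_sym.
  (* Moving the root from [u] to its neighbour [b] leaves the parent of [w] unchanged, hence of odd
     degree. *)
  by rewrite (par_adjacent_root eub) ?puw ?orbT.
have [/existsP[b /andP[ewb ob]]|/existsPn w_odd] :=
    boolP [exists b, e w b && ~~ odd (degree e b)].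
  have ub : u != b by apply: contraNneq nwu => ->.
  apply: (edge_graceful_even_root uw u2 w2 deg2 nuw ub (edge_neq ewb) ob).
    by rewrite (par_adjacent_root ewb) ?pwu ?orbT.
  by rewrite par_adjacent ?eqxx // e_sym.
have [t [ot tu tw]] := third_even_degree uw u2 w2.
have ut : u != t by rewrite eq_sym.
have wt : w != t by rewrite eq_sym.
(* All neighbours of [u] and [w] have odd degree here, in particular their parents for the root
   [t]. *)
apply: (edge_graceful_even_root uw u2 w2 deg2 nuw ut wt ot).
  by have := u_odd (par t u); rewrite e_sym par_edge // negbK => ->; rewrite orbT.
by have := w_odd (par t w); rewrite e_sym par_edge // negbK => ->; rewrite orbT.
Qed.

End Tree.

Theorem theorem2 (V : finType) (e : rel V)
    (e_sym : symmetric e) (e_irr : irreflexive e)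
    (e_tree : is_tree e)
    (V_odd : odd #|V|)
    (few_deg2 : #|[set v | degree e v == 2]| <= 2) :
  edge_graceful e /\ antimagic e.
Proof.
suff eg : edge_graceful e by split=> //; apply: edge_graceful_antimagic.
have cardV : #|V| = (#|V|./2.*2).+1 by rewrite -{1}(odd_double_half #|V|) V_odd.
have [le1|/card_gt1P[u [w [u2 w2 uw]]]] := leqP #|[set v | degree e v == 2]| 1.
  exact: edge_graceful_one_deg2 cardV le1.
rewrite !inE in u2 w2.
apply: (edge_graceful_two_deg2 e_sym e_irr e_tree cardV uw (eqP u2) (eqP w2)) => v vu vw.
apply: contraTN few_deg2 => v2; rewrite -ltnNge.
have sub : [set v; u; w] \subset [set v | degree e v == 2].
  by apply/subsetP => x; rewrite !inE -orbA => /or3P[] /eqP ->.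
apply: leq_trans (subset_leq_card sub).
by rewrite -setUA cardsU1 cards2 uw !inE negb_or vu vw.
Qed.
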